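(* There exists an absolute constant $c$ such that the following holds. Let $\mathfrak{L}_1,\mathfrak{L}_2,\mathfrak{L}_3$ be finite collections of $L_1$, $L_2$ and $L_3$, respectively, lines in $\mathbb{R}^3$. Let $J$ be the set of multijoints formed by the collections $\mathfrak{L}_1,\mathfrak{L}_2$ and $\mathfrak{L}_3$. Then $$|J| \leq c\cdot (L_1L_2L_3)^{1/2}.$$
   Context: A collection of lines is a set of distinct lines. A point $x\in\mathbb{R}^3$ is a multijoint formed by $\mathfrak{L}_1,\mathfrak{L}_2,\mathfrak{L}_3$ if for each $i=1,2,3$ there exists a line $l_i\in\mathfrak{L}_i$ with $x\in l_i$, such that the directions of $l_1,l_2,l_3$ span $\mathbb{R}^3$. *)

(* Defs.v *)
From HB Require Import structures.
From mathcomp Require Import all_boot all_order all_algebra.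
From mathcomp Require Import boolp classical_sets functions cardinality reals.

Set Implicit Arguments.
Unset Strict Implicit.
Unset Printing Implicit Defensive.

Import Order.TTheory GRing.Theory Num.Theory.

Local Open Scope classical_set_scope.
Local Open Scope ring_scope.

Section Multijoints.
Variable R : realType.

Definition line_through (p v : 'rV[R]_3) : set 'rV[R]_3 :=
  [set x | exists t : R, x = p + t *: v].

(* A direction vector is determined by the line up to a nonzero scalar. *)
Definition is_direction (l : set 'rV[R]_3) (v : 'rV[R]_3) : Prop :=
  v != 0 /\ exists p, l = line_through p v.

Definition is_line (l : set 'rV[R]_3) : Prop := exists v, is_direction l v.

Definition multijoint (LL1 LL2 LL3 : set (set 'rV[R]_3)) (x : 'rV[R]_3) : Prop :=
  exists l1 l2 l3 : set 'rV[R]_3,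
    [/\ LL1 l1 /\ l1 x, LL2 l2 /\ l2 x, LL3 l3 /\ l3 x &
      exists v1 v2 v3 : 'rV[R]_3,
        [/\ is_direction l1 v1, is_direction l2 v2, is_direction l3 v3 &
          (<<[:: v1; v2; v3]>> = fullv)%VS]].

Definition multijoints (LL1 LL2 LL3 : set (set 'rV[R]_3)) : set 'rV[R]_3 :=
  [set x | multijoint LL1 LL2 LL3 x].

End Multijoints.

(* Main.v *)
(* After pruning, some nonempty set [S] of multijoints has the property that every
   line of the [i]-th family meeting [S] carries at least [n / (4 L_i)] points of [S],
   where [n = |J|].  If [n^2] were larger than [12^3 L_1 L_2 L_3], there would be more
   grid values [{0, .., n-1}^3 -> R] than linear conditions on the interpolating
   polynomial [g] saying that at each [p] in [S] the mixed derivatives of orders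
   [m_i < 12 L_i] along the three lines at [p] vanish; so some such [g] is nonzero.
   By induction on [k], all derivatives of [g] of order [k] vanish on [S]: if
   [m_i >= 12 L_i], let [h] be the derivative of [g] along the other two directions.
   On the [i]-th line through [p], [h] vanishes to order [12 L_i] at [n / (4 L_i)]
   points, by induction, which exceeds its degree [3 (n - 1)]; so [h] is zero on that
   line.  Hence [g = 0] by Taylor expansion, a contradiction.  The argument works
   verbatim in dimension [d]. *)

Require Import Defs.
From HB Require Import structures.
From mathcomp Require Import all_boot all_order all_algebra.
From mathcomp Require Import boolp classical_sets functions cardinality reals.
From mathcomp Require Import lra zify mpoly.

Set Implicit Arguments.
Unset Strict Implicit.
Unset Printing Implicit Defensive.

Import Order.TTheory GRing.Theory Num.Theory.

Local Open Scope classical_set_scope.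
Local Open Scope ring_scope.

(** Commuting steps let the head of [s] be pulled to the front of [t]. This is what makes the order
    of iterated derivatives irrelevant. *)
Lemma foldr_perm (T : eqType) (A : Type) (f : T -> A -> A) (s t : seq T) (z : A) :
  (forall x y a, f x (f y a) = f y (f x a)) ->
  perm_eq s t -> foldr f z s = foldr f z t.
Proof.
move=> fC; elim: s t => [|x s IHs] t.
  by rewrite perm_sym => /perm_nilP ->.
move=> st; have /splitPr t_split : x \in t by rewrite -(perm_mem st) mem_head.
case: t_split st => t1 t2 st.
have -> /= : foldr f z (t1 ++ x :: t2) = foldr f z (x :: t1 ++ t2).
  by elim: t1 {st} => //= y t1 ->.
congr (f x _); apply: IHs; rewrite -(perm_cons x); apply: perm_trans st _.
exact/permPl/(perm_catCA t1 [:: x] t2).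
Qed.

(** * Directional derivatives and restriction of polynomials to lines *)

Section DirectionalDerivative.
Variables (F : fieldType) (d : nat).
Implicit Types (g h : {mpoly F[d]}) (x u w : 'rV[F]_d) (ws : seq 'rV[F]_d).

Definition dderiv w g : {mpoly F[d]} := \sum_i w 0 i *: mderiv i g.

Lemma dderiv_is_linear w : linear (dderiv w).
Proof.
move=> a g h; rewrite /dderiv scaler_sumr -big_split; apply: eq_bigr => i _ /=.
by rewrite linearP scalerDr !scalerA mulrC.
Qed.

HB.instance Definition _ w := GRing.isLinear.Build F {mpoly F[d]} {mpoly F[d]}
  _ (dderiv w) (dderiv_is_linear w).

Lemma dderiv_comb (I : finType) (c : I -> F) (u : I -> 'rV[F]_d) g :
  dderiv (\sum_i c i *: u i) g = \sum_i c i *: dderiv (u i) g.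
Proof.
under [RHS]eq_bigr do rewrite /dderiv scaler_sumr.
rewrite exchange_big; apply: eq_bigr => j _; rewrite summxE scaler_suml.
by apply: eq_bigr => i _; rewrite mxE scalerA.
Qed.

Lemma dderivC u w g : dderiv u (dderiv w g) = dderiv w (dderiv u g).
Proof.
rewrite /dderiv; under eq_bigr do rewrite [mderiv _ _]linear_sum scaler_sumr.
under [RHS]eq_bigr do rewrite [mderiv _ _]linear_sum scaler_sumr.
rewrite exchange_big; apply: eq_bigr => i _; apply: eq_bigr => j _ /=.
by rewrite !linearZ /= mderiv_comm !scalerA mulrC.
Qed.

Lemma dderivM w g h : dderiv w (g * h) = dderiv w g * h + g * dderiv w h.
Proof.
rewrite /dderiv mulr_suml mulr_sumr -big_split; apply: eq_bigr => i _ /=.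
by rewrite mderivM scalerDr scalerAl scalerAr.
Qed.

Lemma msize_dderiv w g : (msize (dderiv w g) <= msize g)%N.
Proof.
apply: leq_trans (mmeasure_sum _ _ _ _) _; apply/bigmax_leqP => i _.
apply: leq_trans (msizeZ_le _ _) _; apply: leq_trans (mmeasure_sum _ _ _ _) _.
rewrite big_seq; apply/bigmax_leqP_seq => m mg _.
apply: leq_trans (msizeZ_le _ _) _; rewrite msizeX.
by apply: leq_trans (msize_mdeg_lt mg); rewrite ltnS mdegB.
Qed.

Definition dderivs ws g := foldr dderiv g ws.

Lemma dderivs_cons w ws g : dderivs (w :: ws) g = dderiv w (dderivs ws g).
Proof. by []. Qed.

Lemma dderivs_is_linear ws : linear (dderivs ws).
Proof. by elim: ws => // w ws IH a g h; rewrite !dderivs_cons IH linearP. Qed.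

HB.instance Definition _ ws := GRing.isLinear.Build F {mpoly F[d]} {mpoly F[d]}
  _ (dderivs ws) (dderivs_is_linear ws).

Lemma dderivs_perm ws ws' g :
  perm_eq ws ws' -> dderivs ws g = dderivs ws' g.
Proof. exact/foldr_perm/dderivC. Qed.

Lemma dderivs_cat ws ws' g : dderivs (ws ++ ws') g = dderivs ws (dderivs ws' g).
Proof. exact: foldr_cat. Qed.

Lemma msize_dderivs ws g : (msize (dderivs ws g) <= msize g)%N.
Proof. by elim: ws => //= w ws; apply/leq_trans/msize_dderiv. Qed.

(** Multilinearity and commutation: each direction is expanded in the [u i], one at a time. *)
Lemma dderivs_span (u : 'I_d -> 'rV[F]_d) g (v : 'I_d -> F) k :
  (forall w, exists c : 'I_d -> F, w = \sum_i c i *: u i) ->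
  (forall t : seq 'I_d, size t = k -> (dderivs (map u t) g).@[v] = 0) ->
  forall ws, size ws = k -> (dderivs ws g).@[v] = 0.
Proof.
move=> u_span gv0 ws szws.
(* Strengthened for the induction: [t] collects the directions already expanded. *)
suff gen t : (size ws + size t)%N = k -> (dderivs (ws ++ map u t) g).@[v] = 0.
  by rewrite -(gen [::]) ?cats0 ?addn0.
elim: ws {szws} t => [|w ws IH] t /= szk; first exact: gv0.
have [c ->] := u_span w; rewrite dderiv_comb raddf_sum big1 // => i _.
rewrite /= mevalZ -[dderiv _ _]/(dderivs (u i :: ws ++ map u t) g).
rewrite (@dderivs_perm _ (ws ++ map u (i :: t))) ?IH ?mulr0 //=.
  by rewrite addnS -addSn.
exact/permPl/(perm_catCA [:: u i] ws).
Qed.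

(** The restriction of [g] to the line through [x] along [w], as a polynomial in the parameter of
    the line. *)
Definition on_line x w g : {poly F} :=
  mmap (@polyC F) (fun i => (x 0 i)%:P + (w 0 i)%:P * 'X) g.

Lemma on_lineD x w g h : on_line x w (g + h) = on_line x w g + on_line x w h.
Proof. exact: mmapD. Qed.

Lemma on_lineM x w g h : on_line x w (g * h) = on_line x w g * on_line x w h.
Proof. exact: rmorphM. Qed.

Lemma on_lineZ x w a g : on_line x w (a *: g) = a *: on_line x w g.
Proof. by rewrite /on_line mmapZ mul_polyC. Qed.

Lemma horner_on_line x w g s : (on_line x w g).[s] = g.@[(x + s *: w) 0].
Proof.
rewrite mevalE /on_line /mmap horner_sum; apply: eq_bigr => m _.
rewrite hornerM hornerC /mmap1 horner_prod; congr (_ * _); apply: eq_bigr => i _.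
by rewrite horner_exp !hornerE !mxE mulrC.
Qed.

(** This is the chain rule. Both sides are linear in [g] and obey the Leibniz rule, so constants and
    variables suffice. *)
Lemma deriv_on_line x w g : (on_line x w g)^`() = on_line x w (dderiv w g).
Proof.
pose P g := (on_line x w g)^`() = on_line x w (dderiv w g).
have PM g1 g2 : P g1 -> P g2 -> P (g1 * g2).
  by rewrite /P dderivM on_lineD !on_lineM derivM => -> ->.
have PC c : P c%:MP.
  rewrite /P /on_line mmapC derivC /dderiv big1 ?mmap0 // => i _.
  by rewrite mderivC scaler0.
have PX i : P 'X_i.
  rewrite /P /on_line mmapX mmap1U derivD derivC derivM derivC derivX.
  rewrite mul0r !add0r mulr1 /dderiv (bigD1 i) //= big1 => [|j ji]; last first.
    by rewrite mderivX mnm1E eq_sym (negPf ji) scale0r scaler0.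
  rewrite addr0 mderivX mnm1E eqxx scale1r.
  have -> : (U_(i) - U_(i))%MM = 0%MM :> 'X_{1..d}.
    by apply/mnmP => k; rewrite mnmBE subnn mnm0E.
  by rewrite mpolyX0 mmapZ rmorph1 mulr1.
have PXm m : P 'X_[m].
  rewrite mpolyXE_id; apply: (big_ind P) => //; first exact: (PC 1).
  move=> i _; elim: (m i) => [|k IH]; first exact: (PC 1).
  by rewrite exprS; apply: PM.
suff : P g by [].
elim/mpolyind: g => [|c m g _ _ IH]; first by rewrite -mpolyC0; apply: PC.
by rewrite /P linearP !on_lineD !on_lineZ derivD derivZ PXm IH.
Qed.

Lemma derivn_on_line x w g k :
  (on_line x w g)^`(k) = on_line x w (dderivs (nseq k w) g).
Proof. by elim: k => // k IH; rewrite derivnS IH deriv_on_line. Qed.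

Lemma size_on_line x w g : (size (on_line x w g) <= msize g)%N.
Proof.
rewrite /on_line /mmap; apply: leq_trans (size_sum _ _ _) _.
rewrite big_seq; apply/bigmax_leqP_seq => m mg _.
rewrite mul_polyC; apply: leq_trans (size_scale_leq _ _) _.
apply: leq_trans (msize_mdeg_lt mg); rewrite mdegE /mmap1.
apply: (big_ind2 (fun (p : {poly F}) n => (size p <= n.+1)%N)) => [|p a q b pa qb|i _].
- by rewrite size_poly1.
- by apply: leq_trans (size_polyMleq _ _) _; lia.
have : (size ((x 0 i)%:P + (w 0 i)%:P * 'X)%R <= 2)%N.
  rewrite (leq_trans (size_polyD _ _)) // geq_max (leq_trans (size_polyC_leq1 _)) //.
  by rewrite mul_polyC (leq_trans (size_scale_leq _ _)) ?size_polyX.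
move=> sz; apply: leq_trans (size_poly_exp_leq _ _) _; rewrite ltnS.
by rewrite -[leqRHS]mul1n leq_mul2r; apply/orP; right; lia.
Qed.

End DirectionalDerivative.

(** * Univariate polynomials with prescribed zeros of high order *)

Lemma dvdp_XsubC_exp (F : numFieldType) (f : {poly F}) (a : F) (b : nat) :
  (forall k, (k < b)%N -> f^`(k).[a] = 0) -> ('X - a%:P) ^+ b %| f.
Proof.
move=> fa0.
have -> : f = \sum_(k < size f) (f^`N(k).[a])%:P * ('X - a%:P) ^+ k.
  (* Taylor expansion at [a], with ['X] read as [a + ('X - a)]. *)
  rewrite -[LHS]comp_polyXr /comp_poly -[X in _.[X]](subrKC a%:P).
  rewrite nderiv_taylor; last exact: mulrC.
  rewrite size_map_polyC; apply: eq_bigr => k _.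
  by rewrite nderivn_map horner_map.
apply: (big_ind (fun q => _ %| q)) => [|p q|k _]; first exact: dvdp0.
  by move=> *; rewrite dvdp_add.
have [kb|bk] := ltnP k b; last by rewrite dvdp_mull // dvdp_exp2l.
(* Characteristic zero: [k!] can be cancelled to reach the Taylor coefficient. *)
have /eqP := fa0 k kb; rewrite nderivn_def hornerMn mulrn_eq0 -leqn0 leqNgt fact_gt0.
by move/eqP->; rewrite mul0r dvdp0.
Qed.

Lemma poly_eq0_derivn (F : numFieldType) (f : {poly F}) (I : finType)
    (A : {set I}) (s : I -> F) (b : nat) :
  {in A &, injective s} ->
  (forall i k, i \in A -> (k < b)%N -> f^`(k).[s i] = 0) ->
  (size f <= b * #|A|)%N -> f = 0.
Proof.
move=> s_inj fs0 szf; pose Q := \prod_(i in A) ('X - (s i)%:P) ^+ b.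
have Qf : Q %| f.
  rewrite /Q -big_enum; have : {subset enum A <= A} by move=> i; rewrite mem_enum.
  elim: (enum A) (enum_uniq A) => [|i r IH] /=; first by rewrite big_nil dvd1p.
  case/andP=> ir r_uniq rA; rewrite big_cons Gauss_dvdp.
    rewrite dvdp_XsubC_exp => [/=|k kb]; last by rewrite fs0 ?rA ?mem_head.
    by apply: IH => // j jr; rewrite rA // inE jr orbT.
  rewrite big_seq; apply: (big_ind (fun q => coprimep _ q)) => [|p q|j jr].
  - exact: coprimep1.
  - by rewrite coprimepMr => -> ->.
  apply/coprimep_expl/coprimep_expr/coprimep_XsubC2; rewrite subr_eq0.
  apply: contraNneq ir => /s_inj <- //; by rewrite rA ?mem_head // inE jr orbT.
(* [Q] has size [b * #|A| + 1], too large to divide a nonzero [f]. *)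
apply/eqP; apply: contraLR szf => f0; rewrite -ltnNge.
apply: leq_trans (dvdp_leq f0 Qf); rewrite size_prod => [|i _]; last first.
  by rewrite expf_neq0 // polyXsubC_eq0.
under eq_bigr do rewrite size_exp_XsubC.
by rewrite sum_nat_const mulnS subSn ?leq_addr // addKn mulnC.
Qed.

(** * Parameter counting and pruning *)

Lemma exists_nontrivial_solution (F : fieldType) (I E : finType) (a : I -> E -> F) :
  (#|E| < #|I|)%N ->
  exists c : I -> F, (exists i, c i != 0) /\ forall e, \sum_i c i * a i e = 0.
Proof.
move=> ltEI; pose M := \matrix_(i < #|I|, j < #|E|) a (enum_val i) (enum_val j).
have ker0 : kermx M != 0.
  (* More rows than columns force a nonzero left kernel. *)
  by rewrite -mxrank_eq0 mxrank_ker subn_eq0 -ltnNge (leq_ltn_trans (rank_leq_col M)).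
pose c := nz_row (kermx M).
have cM : c *m M = 0 by apply/sub_kermxP/nz_row_sub.
exists (fun i => c 0 (enum_rank i)); split.
  have /rV0Pn[j cj] : c != 0 by rewrite nz_row_eq0.
  by exists (enum_val j); rewrite enum_valK.
move=> e; have /rowP/(_ (enum_rank e)) := cM; rewrite mxE [RHS]mxE => {2}<-.
rewrite [RHS](reindex _ (onW_bij _ (@enum_rank_bij I))); apply: eq_bigr => i _ /=.
by rewrite mxE !enum_rankK.
Qed.

(* Removing from [S] a line that carries fewer points than its price [w i] increases
   the number of points of [S] minus the total price of the lines it meets. *)
Lemma dense_subset (T I : finType) (L : I -> nat) (f : forall i, T -> 'I_(L i)) :
  (0 < #|T|)%N ->
  exists2 S : {set T}, S != finset.set0 &
    forall i p, p \in S ->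
      (#|T| <= #|I|.+1 * L i * #|[set q in S | f i q == f i p]|)%N.
Proof.
move=> T0; pose w i : rat := #|T|%:R / (#|I|.+1 * L i)%:R.
pose Phi (S : {set T}) : rat := #|S|%:R - \sum_i w i * #|f i @: S|%:R.
have [S _ Smax] := @arg_maxP _ _ _ (finset.set0 : {set T}) predT Phi isT.
have L0 i : (0 < L i)%N.
  by have /card_gt0P[p _] := T0; apply: leq_ltn_trans (ltn_ord (f i p)).
exists S.
  (* The empty set has [Phi] equal to 0, while all of [T] has positive [Phi]: each family costs at
     most [#|T| / (#|I| + 1)], and there are only [#|I|] families. *)
  apply/eqP => S0; have := Smax [set: T]%SET isT.
  rewrite S0 /Phi cards0 big1 ?subr0 => [|i _]; last by rewrite imset0 cards0 mulr0.
  apply/negP; rewrite -ltNge subr_gt0 cardsT.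
  have wle i : w i * #|f i @: [set: T]%SET|%:R <= #|T|%:R / #|I|.+1%:R.
    rewrite /w natrM invfM -!mulrA ler_wpM2l // ler_piMr ?invr_ge0 //.
    rewrite ler_pdivrMl ?ltr0n // mulr1 ler_nat.
    by rewrite -[leqRHS]card_ord max_card.
  apply: le_lt_trans (ler_sum _ (fun i _ => wle i)) _.
  rewrite sumr_const -[_ *+ #|I|]mulr_natr mulrAC ltr_pdivrMr ?ltr0n //.
  by rewrite ltr_pM2l ?ltr0n // ltr_nat.
(* Deleting [C], the points of [S] on one line, saves at least [w i]; maximality of [S] then forces
   [w i <= #|C|]. *)
move=> i p pS; set C := [set q in S | _].
have := Smax (S :\: C)%SET isT; rewrite /Phi.
have imsub j : f j @: (S :\: C)%SET \subset f j @: S by rewrite imsetS ?finset.subsetDl.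
have sumle : \sum_j w j * #|f j @: (S :\: C)%SET|%:R <=
    \sum_j w j * #|f j @: S|%:R - w i.
  rewrite (bigD1 i) //= [in leRHS](bigD1 i) //= addrAC lerD //; last first.
    by apply: ler_sum => j _; rewrite ler_wpM2l ?divr_ge0 // ler_nat subset_leq_card.
  rewrite -[X in _ - X]mulr1 -mulrBr ler_wpM2l ?divr_ge0 // lerBrDr natr1 ler_nat.
  rewrite (cardsD1 (f i p) (f i @: S)) imset_f // add1n ltnS subset_leq_card //.
  apply/fintype.subsetP => y /imsetP[q]; rewrite !inE negb_and => /andP[/orP[/negP//|fq] qS ->].
  by rewrite fq imset_f.
have cardS : #|S| = (#|C| + #|(S :\: C)%SET|)%N.
  have CS : C \subset S by apply/fintype.subsetP => q; rewrite inE => /andP[].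
  by rewrite -(cardsID C S) (finset.setIidPr CS).
rewrite cardS natrD /= => PhiS.
have : w i <= #|C|%:R by lra.
by rewrite /w ler_pdivrMr ?ltr0n ?muln_gt0 ?L0 // -natrM ler_nat mulnC.
Qed.

(** * Interpolation basis on the grid *)

Section LagrangeBasis.
Variables (F : numFieldType) (d n : nat).
Implicit Types z : {ffun 'I_d -> 'I_n}.

Definition grid_point z : 'rV[F]_d := \row_i (z i)%:R.

(** Left unnormalised: only being nonzero at [z] and zero at the other grid points matters. *)
Definition lagrange z : {mpoly F[d]} :=
  \prod_i \prod_(k < n | k != z i) ('X_i - (k%:R)%:MP).

Lemma lagrange_eq0 z z' : ((lagrange z).@[grid_point z' 0] == 0) = (z != z').
Proof.
rewrite /lagrange rmorph_prod; apply/idP/idP => [|zz'].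
  apply: contraTneq => <-; apply/prodf_neq0 => i _ /=; rewrite rmorph_prod.
  apply/prodf_neq0 => k kz /=.
  by rewrite mevalB mevalXU mevalC mxE subr_eq0 eqr_nat eq_sym.
have /existsP[i zi] : [exists i, z' i != z i].
  by rewrite -negb_forall; apply: contra zz' => /forallP/= e; apply/eqP/ffunP => i; rewrite (eqP (e i)).
rewrite (bigD1 i) //= rmorph_prod (bigD1 (z' i)) //=.
by rewrite mevalB mevalXU mevalC mxE subrr !mul0r.
Qed.

Lemma msize_prod_leq (I : finType) (P : pred I) (G : I -> {mpoly F[d]}) :
  (msize (\prod_(i | P i) G i) <= (\sum_(i | P i) (msize (G i)).-1).+1)%N.
Proof.
apply: (big_ind2 (fun (g : {mpoly F[d]}) a => (msize g <= a.+1)%N)) => [|g a h b ga hb|i _].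
- by rewrite msize1.
- have [->|g0] := eqVneq g 0; first by rewrite mul0r msize0.
  have [->|h0] := eqVneq h 0; first by rewrite mulr0 msize0.
  rewrite msizeM // -subn1 leq_subLR; apply: leq_trans (leq_add ga hb) _.
  by rewrite addSn addnS.
by rewrite leqSpred.
Qed.

Lemma msize_lagrange z : (msize (lagrange z) <= (d * n.-1).+1)%N.
Proof.
apply: leq_trans (msize_prod_leq _ _) _; rewrite ltnS.
rewrite -[leqRHS]/(d * n.-1)%N -[d in leqRHS]card_ord -sum_nat_const; apply: leq_sum => i _.
rewrite -subn1 leq_subLR; apply: leq_trans (msize_prod_leq _ _) _; rewrite add1n ltnS.
apply: leq_trans (_ : \sum_(k < n | k != z i) 1 <= _)%N; last first.
  by rewrite sum1_card cardC1 card_ord.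
apply: leq_sum => k _; rewrite -subn1 leq_subLR.
apply: leq_trans (msizeD_le _ _) _; rewrite geq_max msizeX mdeg1 mmeasureN.
by rewrite msizeC (leq_trans (leq_b1 _)).
Qed.

End LagrangeBasis.

(** * Propagation of vanishing derivatives *)

Section Vanishing.
Variables (F : numFieldType) (d : nat).

Definition mono_dirs (u : 'I_d -> 'rV[F]_d) (m : 'I_d -> nat) : seq 'rV[F]_d :=
  map u (flatten [seq nseq (m i) i | i <- enum 'I_d]).

(** Sorting by index turns any derivative along the [u i] into one of the form [mono_dirs]. *)
Lemma perm_mono (t : seq 'I_d) :
  perm_eq t (flatten [seq nseq (count_mem i t) i | i <- enum 'I_d]).
Proof.
apply/seq.permP => a; rewrite count_flatten sumnE 2!big_map big_enum /=.
rewrite -sum1_count (partition_big id predT) //=; apply: eq_bigr => i _.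
rewrite count_nseq -sum1_count big_distrr /= big_mkcond [RHS]big_mkcond /=.
by apply: eq_bigr => j _; case: eqP => [->|]; rewrite ?andbF ?andbT //; case: (a i).
Qed.

(** Strong induction on the number of derivatives, over arbitrary direction lists: at another point
    [q] of a line through [p], the induction hypothesis is applied to directions chosen at [p],
    which need not be those of [u q]. *)
Lemma dderivs_eq0 (T : finType) (S : {set T}) (x : T -> 'rV[F]_d)
    (u : T -> 'I_d -> 'rV[F]_d) (A : 'I_d -> T -> {set T}) (b : 'I_d -> nat)
    (g : {mpoly F[d]}) :
  injective x ->
  (forall p w, exists c : 'I_d -> F, w = \sum_i c i *: u p i) ->
  (forall i p, p \in S -> A i p \subset S) ->
  (forall i p q, q \in A i p -> exists s, x q = x p + s *: u p i) ->
  (forall i p, p \in S -> (msize g <= b i * #|A i p|)%N) ->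
  (forall p (m : 'I_d -> nat), p \in S -> (forall i, (m i < b i)%N) ->
    (dderivs (mono_dirs (u p) m) g).@[x p 0] = 0) ->
  forall p ws, p \in S -> (dderivs ws g).@[x p 0] = 0.
Proof.
move=> x_inj u_span AS Ax szg g0 p ws; move: {2}(size ws) (erefl (size ws)) => k.
elim/ltn_ind: k p ws => k IH p ws szk pS.
apply: dderivs_span (u_span p) _ _ szk => t szt {ws}.
have [/forallP small|] := boolP [forall i, (count_mem i t < b i)%N].
  by rewrite (dderivs_perm _ (perm_map (u p) (perm_mono t))) g0.
rewrite negb_forall => /existsP[i]; rewrite -leqNgt => big.
(* All [a >= b i] copies of direction [i] are split off; the remaining directions define [h]. *)
set a := count_mem i t in big.
pose t' := [seq j <- t | j != i].
have tE : perm_eq t (nseq a i ++ t').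
  rewrite -(perm_filterC (pred1 i) t) perm_cat2r.
  by rewrite (all_pred1P _ _ (filter_all (pred1 i) t)) size_filter.
rewrite (dderivs_perm _ (perm_map (u p) tE)) map_cat map_nseq dderivs_cat.
set h := dderivs (map (u p) t') g.
have szt' : (a + size t' = k)%N by rewrite -szt (perm_size tE) size_cat size_nseq.
pose pos q := xget 0 [set s | x q = x p + s *: u p i].
have posP q : q \in A i p -> x q = x p + pos q *: u p i.
  by move=> /Ax[s xs]; apply: (@xgetPex _ 0 [set s | x q = x p + s *: u p i]); exists s.
have h0 : on_line (x p) (u p i) h = 0.
  apply: (@poly_eq0_derivn _ _ _ (A i p) pos (b i)) => [q q' qA q'A posE|q c qA cb|].
  - by apply: x_inj; rewrite (posP q) // (posP q') // posE.
  (* Since [c < b i <= a], fewer than [k] derivatives are taken in total. *)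
  - rewrite derivn_on_line horner_on_line -posP // -dderivs_cat.
    apply: (IH (c + size t')%N) => //; last by apply: (fintype.subsetP (AS i p pS)).
      by rewrite -szt' ltn_add2r (leq_trans cb).
    by rewrite size_cat size_nseq size_map.
  - apply: leq_trans (szg i p pS); apply: leq_trans (size_on_line _ _ _) _.
    exact: msize_dderivs.
(* Parameter [0] is the point [x p] itself. *)
have := horner_on_line (x p) (u p i) (dderivs (nseq a (u p i)) h) 0.
by rewrite scale0r addr0 -derivn_on_line h0 linear0 horner0.
Qed.

(** On the line from [x] to [y], the restriction of [g] vanishes at parameter [0] to an order above
    its degree. *)
Lemma meval_eq0_dderivs (g : {mpoly F[d]}) (x y : 'rV[F]_d) :
  (forall ws, (dderivs ws g).@[x 0] = 0) -> g.@[y 0] = 0.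
Proof.
move=> g0; have := horner_on_line x (y - x) g 1; rewrite scale1r subrKC => <-.
pose f := on_line x (y - x) g; suff -> : on_line x (y - x) g = 0 by rewrite horner0.
apply: (@poly_eq0_derivn _ _ unit [set: unit]%SET (fun=> 0) (size f)) => [[] []//|_ k _ _|].
  by rewrite derivn_on_line horner_on_line scale0r addr0.
by rewrite cardsT card_unit muln1.
Qed.

End Vanishing.

(** * The bound in dimension [d] *)

Theorem multijoint_bound (F : numFieldType) (d n : nat) (L : 'I_d -> nat)
    (x : 'I_n -> 'rV[F]_d) (u : 'I_n -> 'I_d -> 'rV[F]_d)
    (l : forall i, 'I_n -> 'I_(L i)) :
  (0 < n)%N -> injective x ->
  (forall p w, exists c : 'I_d -> F, w = \sum_i c i *: u p i) ->
  (forall i p q, l i q = l i p -> exists s, x q = x p + s *: u p i) ->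
  (n ^ d <= n * \prod_i (d * d.+1 * L i))%N.
Proof.
move=> n0 x_inj u_span lx; rewrite leqNgt; apply/negP => lt.
have [|S /set0Pn[p0 p0S] Sdense] := @dense_subset 'I_n _ _ l; first by rewrite card_ord.
pose b i := (d * d.+1 * L i)%N.
(* Conditions are imposed at all [n] points, not only on [S]; there are still fewer of them than the
   [n ^ d] coefficients. *)
pose E := ('I_n * {dffun forall i : 'I_d, 'I_(b i)})%type.
have [|c [[z cz0] ceq]] := @exists_nontrivial_solution F {ffun 'I_d -> 'I_n} E
  (fun z e => (dderivs (mono_dirs (u e.1) (fun i => e.2 i)) (lagrange F z)).@[x e.1 0]).
  rewrite card_ffun !card_ord card_prod card_ord.
  apply: leq_ltn_trans lt; rewrite leq_mul2l; apply/orP; right.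
  by rewrite card_dep_ffun foldrE big_map big_enum /=; apply: leq_prod => i _; rewrite card_ord.
pose g := \sum_z c z *: lagrange F z.
have szg : (msize g <= (d * n.-1).+1)%N.
  apply: leq_trans (msize_sum _ _ _) _; apply/bigmax_leqP => z' _.
  exact: leq_trans (msizeZ_le _ _) (msize_lagrange _ _).
have g0 : g.@[grid_point F z 0] = 0.
  apply: (@meval_eq0_dderivs _ _ _ (x p0)) => ws.
  apply: (@dderivs_eq0 _ _ _ S x u (fun i p => [set q in S | l i q == l i p]) b) => //.
  - by move=> i p _; apply/fintype.subsetP => q; rewrite inE => /andP[].
  - by move=> i p q; rewrite inE => /andP[_ /eqP/lx].
  (* The size [d * (n - 1) + 1] is at most [d * n] because [i] witnesses [0 < d]; density of [S]
     gives the rest. *)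
  - move=> i p pS; apply: leq_trans szg _; have := Sdense i p pS.
    rewrite !card_ord => nle; apply: (@leq_trans (d * n)%N); last first.
      by rewrite /b -!mulnA leq_mul2l mulnA nle orbT.
    by rewrite ltn_pmul2l ?prednK // (leq_ltn_trans _ (ltn_ord i)).
  move=> p m pS mb.
  have := ceq (p, [ffun i => Ordinal (mb i)] : {dffun forall i : 'I_d, 'I_(b i)}).
  rewrite /= => <-; rewrite linear_sum raddf_sum; apply: eq_bigr => z' _ /=.
  rewrite linearZ mevalZ; congr (_ * (dderivs (map _ (flatten _)) _).@[_]).
  by apply: eq_map => i; rewrite ffunE.
(* At grid point [z] only the term of [c z] survives, so [c z] would be zero. *)
case/negP: cz0; have := g0; rewrite /g raddf_sum (bigD1 z) //= big1 => [|z' z'z].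
  by rewrite addr0 mevalZ => /eqP; rewrite mulf_eq0 lagrange_eq0 eqxx orbF.
by apply/eqP; rewrite mevalZ mulf_eq0 lagrange_eq0 z'z orbT.
Qed.

(** * Application to multijoints in three-space *)

Lemma is_direction_sub (R : realType) (l : set 'rV[R]_3) (v x y : 'rV[R]_3) :
  is_direction l v -> l x -> l y -> exists s, y = x + s *: v.
Proof.
case=> _ [p ->] [s ->] [t ->]; exists (t - s).
by rewrite -addrA -scalerDl subrKC.
Qed.

Lemma nth3_span (R : realType) (v1 v2 v3 : 'rV[R]_3) :
  (<<[:: v1; v2; v3]>> = fullv)%VS ->
  forall w, exists c : 'I_3 -> R, w = \sum_i c i *: nth 0 [:: v1; v2; v3] i.
Proof.
move=> span w; have : w \in <<[tuple v1; v2; v3]>>%VS by rewrite /= span memvf.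
by move/coord_span => w_eq; exists (coord [tuple v1; v2; v3] ^~ w).
Qed.

(** Stated for duplicate-free lists so that it yields first the finiteness of the set of multijoints
    and then its size. *)
Lemma multijoints_seq_bound (R : realType) (LL1 LL2 LL3 : set (set 'rV[R]_3))
    (L1 L2 L3 : nat) (s : seq 'rV[R]_3) :
  (LL1 #= `I_L1)%card -> (LL2 #= `I_L2)%card -> (LL3 #= `I_L3)%card ->
  uniq s -> (forall x, x \in s -> multijoint LL1 LL2 LL3 x) ->
  (size s ^ 2 <= 12 ^ 3 * (L1 * L2 * L3))%N.
Proof.
move=> /card_set_bijP[f1 f1bij] /card_set_bijP[f2 f2bij] /card_set_bijP[f3 f3bij].
move=> s_uniq sJ; have [->//|s0] := posnP (size s).
pose x (p : 'I_(size s)) := nth 0 s p.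
have xJ p : multijoint LL1 LL2 LL3 (x p) by apply/sJ/mem_nth.
pose LL (i : 'I_3) := nth set0 [:: LL1; LL2; LL3] i.
pose L (i : 'I_3) := nth 0%N [:: L1; L2; L3] i.
pose f (i : 'I_3) := nth (fun=> 0%N) [:: f1; f2; f3] i.
have fbij i : set_bij (LL i) `I_(L i) (f i).
  by case: i => -[|[|[|//]]] ?.
(* Fix at every point one line of each family, with spanning directions; the bijections [f i] then
   number these lines. *)
have /choice[lv lvP] : forall p, exists lv : ('I_3 -> set 'rV[R]_3) * ('I_3 -> 'rV[R]_3),
    (forall i, [/\ LL i (lv.1 i), lv.1 i (x p) & is_direction (lv.1 i) (lv.2 i)]) /\
    (forall w, exists c : 'I_3 -> R, w = \sum_i c i *: lv.2 i).
  move=> p; have [l1 [l2 [l3 [[? ?] [? ?] [? ?] [v1 [v2 [v3 [? ? ? span]]]]]]]] := xJ p.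
  exists (fun i : 'I_3 => nth set0 [:: l1; l2; l3] i, fun i : 'I_3 => nth 0 [:: v1; v2; v3] i).
  by split; [case=> -[|[|[|//]]] ? | exact: nth3_span].
have f_lt p i : (f i ((lv p).1 i) < L i)%N.
  by have [/(_ i)[LLi _ _] _] := lvP p; have [+ _ _] := fbij i; apply.
have := @multijoint_bound R 3 (size s) L x (fun p => (lv p).2) (fun i p => Ordinal (f_lt p i)) s0.
rewrite !big_ord_recr big_ord0 /= mul1n => bound.
rewrite -(leq_pmul2l s0) -expnS (leq_trans (bound _ _ _)) //.
- by move=> p q /eqP; rewrite nth_uniq // => /eqP/val_inj.
- by move=> p; have [] := lvP p.
- move=> i p q /(congr1 val) /= flpq.
  have [/(_ i)[LLp xp dirp] _] := lvP p; have [/(_ i)[LLq xq _] _] := lvP q.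
  have [_ f_inj _] := fbij i.
  have lqp : (lv q).1 i = (lv p).1 i by apply: f_inj; rewrite ?inE.
  by apply: is_direction_sub dirp xp _; rewrite -lqp.
(* Each factor is [3 * 4 * L i], whence [12 ^ 3]. *)
- by rewrite leq_mul2l /L /=; apply/orP; right; lia.
Qed.

Theorem theorem1p2p1 (R : realType) :
  exists c : R,
    forall (LL1 LL2 LL3 : set (set 'rV[R]_3)) (L1 L2 L3 : nat),
      (forall l, LL1 l -> is_line l) ->
      (forall l, LL2 l -> is_line l) ->
      (forall l, LL3 l -> is_line l) ->
      (LL1 #= `I_L1)%card ->
      (LL2 #= `I_L2)%card ->
      (LL3 #= `I_L3)%card ->
      exists N : nat,
        (multijoints LL1 LL2 LL3 #= `I_N)%card /\
        N%:R <= c * Num.sqrt (L1 * L2 * L3)%N%:R.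
Proof.
exists (Num.sqrt (12 ^ 3)%N%:R) => LL1 LL2 LL3 L1 L2 L3 _ _ _ card1 card2 card3.
have bound := multijoints_seq_bound card1 card2 card3.
have [N cardN] : finite_set (multijoints LL1 LL2 LL3).
  (* An infinite set would contain a finite [B] larger than the bound on [#|B| ^ 2]. *)
  apply: contrapT => /(infinite_set_fset (12 ^ 3 * (L1 * L2 * L3)).+1)[B BJ ltB].
  have := bound _ (finmap.fset_uniq B) (fun x xB => BJ x xB).
  by rewrite leqNgt (leq_trans ltB) // expnS expn1 leq_pmulr // (leq_trans _ ltB).
exists N; split=> //.
rewrite -sqrtrM ?ler0n // -natrM -[N%:R]ger0_norm // -sqrtr_sqr ler_wsqrtr //.
rewrite -natrX ler_nat -(card_fset_set cardN).
apply: bound (finmap.fset_uniq _) _ => x.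
by rewrite in_fset_set ?inE //; exists N.
Qed.
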